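(* For all integers $p\ge2$ and $n\ge0$ and all real numbers $x$ and $y$, $$\sum_{i=0}^{n}\frac{x}{(p+1)i+x}\binom{(p+1)i+x}{i}\,\frac{(p-1)(n-i)+y+1}{p(n-i)+y+1}\binom{(p+1)(n-i)+y}{n-i}=\frac{(p-1)n+x+y+1}{pn+x+y+1}\binom{(p+1)n+x+y}{n}.$$
   Context: For real $a$ and an integer $m\ge0$, $\binom{a}{m}=a(a-1)\cdots(a-m+1)/m!$. Each of the expressions $\frac{x}{(p+1)i+x}\binom{(p+1)i+x}{i}$ and $\frac{(p-1)m+y+1}{pm+y+1}\binom{(p+1)m+y}{m}$ is a polynomial in $x$, respectively $y$ (after cancellation), and for exceptional values of $x$, $y$ or $x+y$ at which a denominator vanishes it is understood as the value of that polynomial. *)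

(* Defs.v *)
From mathcomp Require Import all_boot all_order all_algebra.
From mathcomp Require Import reals.

Set Implicit Arguments.
Unset Strict Implicit.
Unset Printing Implicit Defensive.

Import Order.TTheory GRing.Theory Num.Theory.
Local Open Scope ring_scope.

(* binom(a, m) = a (a - 1) ... (a - m + 1) / m!, for a in any algebra over the
   field R; it is used at A := R^o (real a) and at A := {poly R} (a an
   expression in an indeterminate). *)
Definition gbinom (R : numFieldType) (A : algType R) (a : A) (m : nat) : A :=
  (m`!%:R : R)^-1 *: \prod_(j < m) (a - j%:R).

(* x / ((p+1)i + x) * binom((p+1)i + x, i) as a polynomial in x. The quotient
   %/ is exact (fussP_exact), so evaluating it also gives the conventional
   value at the zero of the denominator; elsewhere it agrees with the
   displayed expression (fussP_horner). *)
Definition fussP (R : numFieldType) (p i : nat) : {poly R} :=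
  ('X * gbinom ((p%:R + 1) * i%:R + 'X) i) %/ ((p%:R + 1) * i%:R + 'X).

(* ((p-1)m + y + 1) / (pm + y + 1) * binom((p+1)m + y, m) as a polynomial in
   y; see cofussP_exact and cofussP_horner. *)
Definition cofussP (R : numFieldType) (p m : nat) : {poly R} :=
  (((p%:R - 1) * m%:R + 'X + 1) * gbinom ((p%:R + 1) * m%:R + 'X) m)
    %/ (p%:R * m%:R + 'X + 1).

Lemma horner_gbinom (R : numFieldType) (q : {poly R}) (m : nat) (x : R) :
  (gbinom q m).[x] = gbinom (q.[x] : R^o) m.
Proof.
rewrite /gbinom hornerZ horner_prod; congr (_ * _).
by apply: eq_bigr => j _; rewrite hornerD hornerN -polyC_natr hornerC.
Qed.

Lemma fussP_exact (R : numFieldType) (p i : nat) :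
  fussP R p i * ((p%:R + 1) * i%:R + 'X) =
    'X * gbinom ((p%:R + 1) * i%:R + 'X) i.
Proof.
rewrite /fussP divpK //; case: i => [|i].
  by rewrite mulr0 add0r dvdp_mulr.
apply: dvdp_mull; rewrite /gbinom -mul_polyC; apply: dvdp_mull.
by rewrite big_ord_recl subr0 dvdp_mulr.
Qed.

Lemma cofussP_exact (R : numFieldType) (p m : nat) :
  cofussP R p m * (p%:R * m%:R + 'X + 1) =
    ((p%:R - 1) * m%:R + 'X + 1) * gbinom ((p%:R + 1) * m%:R + 'X) m.
Proof.
rewrite /cofussP divpK //; case: m => [|m].
  by rewrite !mulr0 dvdp_mulr.
apply: dvdp_mull; rewrite /gbinom -mul_polyC; apply: dvdp_mull.
rewrite big_ord_recr /=; apply: dvdp_mull.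
suff -> : (p%:R + 1) * m.+1%:R + 'X - m%:R = p%:R * m.+1%:R + 'X + 1 :> {poly R}.
  by [].
rewrite mulrDl mul1r -{2}natr1 [m%:R + 1]addrC addrA.
by rewrite [_ + m%:R + 'X]addrAC addrK addrAC.
Qed.

Lemma fussP_horner (R : numFieldType) (p i : nat) (x : R) :
  (p%:R + 1) * i%:R + x != 0 ->
  (fussP R p i).[x] =
    x / ((p%:R + 1) * i%:R + x) * gbinom ((p%:R + 1) * i%:R + x : R^o) i.
Proof.
move=> nz; have := congr1 (horner^~ x) (fussP_exact R p i).
rewrite !hornerM horner_gbinom -!polyC_natr -polyC1 !(hornerM, hornerD, hornerN, hornerX, hornerC) => /(canRL (mulfK nz)) ->.
by rewrite mulrAC.
Qed.

Lemma cofussP_horner (R : numFieldType) (p m : nat) (y : R) :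
  p%:R * m%:R + y + 1 != 0 ->
  (cofussP R p m).[y] =
    ((p%:R - 1) * m%:R + y + 1) / (p%:R * m%:R + y + 1)
      * gbinom ((p%:R + 1) * m%:R + y : R^o) m.
Proof.
move=> nz; have := congr1 (horner^~ y) (cofussP_exact R p m).
rewrite !hornerM horner_gbinom -!polyC_natr -polyC1 !(hornerM, hornerD, hornerN, hornerX, hornerC) => /(canRL (mulfK nz)) ->.
by rewrite mulrAC.
Qed.

(* Main.v *)
Require Import Defs.
From mathcomp Require Import all_boot all_order all_algebra.
From mathcomp Require Import reals.
From mathcomp Require Import ring.

Set Implicit Arguments.
Unset Strict Implicit.
Unset Printing Implicit Defensive.

Import Order.TTheory GRing.Theory Num.Theory.
Local Open Scope ring_scope.

(** Put q = p + 1, A_i(x) = x / (q i + x) binom(q i + x, i) and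
    C_m(y) = binom(q m + y, m). As polynomials,
    A_(i+1)(x) = C_(i+1)(x) - q C_i(x + q - 1), and the second factor of the
    sum is C_m(y) - C_(m-1)(y + q), so the theorem is a difference of two
    instances of the Rothe-Hagen identity sum_i A_i(x) C_(n-i)(y) = C_n(x + y).
    By Pascal's rule A_(i+1)(x+1) - A_(i+1)(x) = A_i(x + q) and
    C_(m+1)(y+1) - C_(m+1)(y) = C_m(y + q); hence, by induction on n, the two
    sides of the Rothe-Hagen identity have the same increments in x. They agree
    at x = 0, thus at all naturals, thus everywhere. *)

Section GeneralizedBinomial.
Variables (R : numFieldType) (A : comAlgType R).
Implicit Types (a : A) (m : nat).

Lemma gbinom0 a : gbinom a 0 = 1.
Proof. by rewrite /gbinom big_ord0 fact0 invr1 scale1r. Qed.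

(** Clearing [m.+1] leaves the prefactor of [gbinom a m] on a product of [m.+1] factors; splitting
    off its last or its first factor gives the next two lemmas. *)
Lemma natr_gbinomS a m :
  m.+1%:R * gbinom a m.+1 = (m`!%:R : R)^-1 *: \prod_(j < m.+1) (a - j%:R).
Proof.
rewrite /gbinom -scalerAr mulr_natl -scaler_nat scalerA; congr (_ *: _).
by rewrite factS natrM invfM mulrAC mulVf ?mul1r // pnatr_eq0.
Qed.

Lemma gbinom_mul_sub a m : (a - m%:R) * gbinom a m = m.+1%:R * gbinom a m.+1.
Proof. by rewrite natr_gbinomS big_ord_recr /= -scalerAr mulrC. Qed.

Lemma gbinom_absorb a m : a * gbinom (a - 1) m = m.+1%:R * gbinom a m.+1.
Proof.
rewrite natr_gbinomS big_ord_recl subr0 -scalerAr; congr (_ *: (_ * _)).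
by apply: eq_bigr => j _; rewrite lift0 -nat1r opprD addrA.
Qed.

Lemma gbinom_pascal a m : gbinom (a + 1) m.+1 = gbinom a m.+1 + gbinom a m.
Proof.
(* [A] need not be an integral domain, so [m.+1] is cancelled as a scalar of [R]. *)
have inj : injective (fun u : A => m.+1%:R * u).
  move=> u v; rewrite !mulr_natl -!scaler_nat => /scalerI; apply.
  by rewrite pnatr_eq0.
apply: inj => /=; rewrite -gbinom_absorb addrK mulrDr -gbinom_mul_sub.
by rewrite -mulrDl -natr1; congr (_ * _); ring.
Qed.

End GeneralizedBinomial.

(** In characteristic zero the naturals below [size f] are [size f] distinct roots, too many for a
    nonzero [f]. *)
Lemma poly_eq0_nat_roots (R : numDomainType) (f : {poly R}) :
  (forall k : nat, f.[k%:R] = 0) -> f = 0.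
Proof.
move=> f0; apply/eqP; apply/negPn/negP => nz.
have := @max_poly_roots R f [seq k%:R | k <- iota 0 (size f)] nz.
rewrite size_map size_iota ltnn => H; suff: false by []; apply: H.
  by apply/allP => _ /mapP[k _ ->]; rewrite /root f0.
by rewrite map_inj_uniq ?iota_uniq //; apply: mulrIn; rewrite oner_eq0.
Qed.

Lemma addX_neq0 (R : nzRingType) (c : R) : c%:P + 'X != 0.
Proof. by rewrite addrC monic_neq0 ?monicXaddC. Qed.

Section RotheHagen.
Variables (R : numFieldType) (p : nat).
Local Notation q := (p%:R + 1).
Local Notation C m y := (gbinom (q * m%:R + y : R^o) m).

Lemma fussP0 : fussP R p 0 = 1.
Proof.
have := fussP_exact R p 0.
rewrite gbinom0 mulr0 add0r mulr1 -{2}['X]mul1r.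
by apply: mulIf; rewrite polyX_eq0.
Qed.

(** After multiplication by the denominator [a], absorption turns the subtracted term into
    [q * i.+1%:R * gbinom a i.+1], and [a - q * i.+1%:R] is ['X]. *)
Lemma fussPS i :
  fussP R p i.+1 = gbinom (q * i.+1%:R + 'X) i.+1
                   - q * gbinom (q * i.+1%:R + 'X - 1) i.
Proof.
have nz : q * i.+1%:R + 'X != 0 :> {poly R}.
  by have := addX_neq0 ((q : R) * i.+1%:R); rewrite polyCM polyCD !polyC_natr.
apply: (mulIf nz); rewrite fussP_exact.
set a := (_ + 'X); rewrite mulrBl -mulrA [_ * a in X in _ - X]mulrC.
rewrite gbinom_absorb /a; ring.
Qed.

Lemma cofussP0 : cofussP R p 0 = 1.
Proof.
have nz : 'X + 1 != 0 :> {poly R} by rewrite addrC -polyC1 addX_neq0.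
have := cofussP_exact R p 0.
rewrite gbinom0 !mulr0 add0r mulr1 -{2}['X + 1]mul1r.
exact: mulIf.
Qed.

(** The numerator is the denominator [a - m%:R] minus [m.+1%:R], and [gbinom_mul_sub] trades one
    factor for the other. *)
Lemma cofussPS m :
  cofussP R p m.+1 = gbinom (q * m.+1%:R + 'X) m.+1
                     - gbinom (q * m.+1%:R + 'X) m.
Proof.
have nz : p%:R * m.+1%:R + 'X + 1 != 0 :> {poly R}.
  have := addX_neq0 ((p%:R : R) * m.+1%:R + 1).
  by rewrite polyCD polyCM !polyC_natr addrAC.
apply: (mulIf nz); rewrite cofussP_exact.
pose a : {poly R} := q * m.+1%:R + 'X; rewrite -/a.
have -> : p%:R * m.+1%:R + 'X + 1 = a - m%:R by rewrite /a -natr1; ring.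
rewrite [RHS]mulrBl [gbinom a m * _]mulrC gbinom_mul_sub /a -natr1; ring.
Qed.

Lemma horner_gbinomX m (y : R) : (gbinom (q * m%:R + 'X) m).[y] = C m y.
Proof.
rewrite horner_gbinom -!polyC_natr -polyC1.
by rewrite !(hornerM, hornerD, hornerX, hornerC).
Qed.

Lemma horner_fussPS i (x : R) :
  (fussP R p i.+1).[x] = C i.+1 x - q * C i (x + q - 1).
Proof.
rewrite fussPS hornerD hornerN horner_gbinomX hornerM horner_gbinom.
rewrite -!polyC_natr -polyC1 !(hornerM, hornerD, hornerN, hornerX, hornerC).
suff -> : q * i.+1%:R + x - 1 = q * i%:R + (x + q - 1) by [].
by rewrite -natr1; ring.
Qed.

Lemma horner_cofussPS m (y : R) :
  (cofussP R p m.+1).[y] = C m.+1 y - C m (y + q).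
Proof.
rewrite cofussPS hornerD hornerN horner_gbinomX horner_gbinom.
rewrite -!polyC_natr -polyC1 !(hornerM, hornerD, hornerN, hornerX, hornerC).
suff -> : q * m.+1%:R + y = q * m%:R + (y + q) by [].
by rewrite -natr1; ring.
Qed.

Lemma shifted_gbinom_succ m (y : R) : C m.+1 (y + 1) = C m.+1 y + C m (y + q).
Proof.
rewrite [in LHS]addrA gbinom_pascal; congr (_ + gbinom _ _).
by rewrite -natr1; ring.
Qed.

Lemma fussP_succ i (x : R) :
  (fussP R p i.+1).[x + 1] = (fussP R p i.+1).[x] + (fussP R p i).[x + q].
Proof.
rewrite !horner_fussPS shifted_gbinom_succ; case: i => [|i].
  by rewrite fussP0 hornerC !gbinom0; ring.
rewrite horner_fussPS.
have -> : x + 1 + q - 1 = x + q - 1 + 1 by ring.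
rewrite shifted_gbinom_succ.
have -> : x + q - 1 + q = x + q + q - 1 by ring.
ring.
Qed.

Lemma fussPS_at0 i : (fussP R p i.+1).[0] = 0.
Proof.
have nz : (p%:R + 1) * i.+1%:R + 0 != 0 :> R.
  by rewrite addr0 natr1 -natrM pnatr_eq0.
by rewrite fussP_horner // !mul0r.
Qed.

Lemma rothe_hagen n (x y : R) :
  \sum_(0 <= i < n.+1) (fussP R p i).[x] * C (n - i)%N y = C n (x + y).
Proof.
elim: n x => [|n IHn] x.
  by rewrite big_nat1 fussP0 hornerC !gbinom0 mulr1.
(* The defect of the identity as a polynomial in x, with y fixed. *)
pose P := \sum_(0 <= i < n.+2) fussP R p i * (C (n.+1 - i)%N y)%:P
          - gbinom (q * n.+1%:R + ('X + y%:P)) n.+1.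
have PE z : P.[z] = \sum_(0 <= i < n.+2) (fussP R p i).[z] * C (n.+1 - i)%N y
                    - C n.+1 (z + y).
  rewrite hornerD hornerN horner_sum horner_gbinom.
  rewrite -!polyC_natr -polyC1 !(hornerM, hornerD, hornerX, hornerC).
  by congr (_ - _); apply: eq_bigr => i _; rewrite hornerM hornerC.
suff P0 : P = 0 by apply/eqP; rewrite -subr_eq0 -PE P0 horner0.
apply: poly_eq0_nat_roots; elim=> [|k IHk].
  (* At x = 0 only the term i = 0 survives. *)
  rewrite PE big_nat_recl // big1 => [|i _]; last by rewrite fussPS_at0 mul0r.
  by rewrite fussP0 hornerC mul1r addr0 add0r subn0 subrr.
(* It remains to see that P takes equal values at k + 1 and k: the increment of the sum is evaluated
   by [IHn] at k + q, that of the right side by Pascal's rule. *)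
rewrite -IHk !PE -natr1 !(big_nat_recl n.+1) //= fussP0 !hornerC.
under eq_bigr do rewrite fussP_succ mulrDl subSS.
rewrite big_split /= IHn.
under [in RHS]eq_bigr do rewrite subSS.
rewrite [k%:R + 1 + y]addrAC shifted_gbinom_succ [k%:R + q + y]addrAC.
ring.
Qed.

End RotheHagen.

Theorem mainTheorem5 (R : realType) (p n : nat) (hp : (2 <= p)%N) (x y : R) :
  \sum_(0 <= i < n.+1) (fussP R p i).[x] * (cofussP R p (n - i)%N).[y]
  = (cofussP R p n).[x + y].
Proof.
case: n => [|n].
  by rewrite big_nat1 fussP0 !cofussP0 !hornerC mulr1.
(* The instances are (n + 1, x, y) and (n, x, y + q). The term i = n + 1 occurs only in the first,
   where both cofactors equal 1. *)
rewrite horner_cofussPS -addrA -!rothe_hagen !(big_nat_recr n.+1) //=.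
rewrite subnn cofussP0 hornerC gbinom0 addrAC; congr (_ + _).
rewrite -sumrB; apply: eq_big_nat => i /andP[_ lt_i].
by rewrite subSn // horner_cofussPS mulrBr.
Qed.
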